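(* The class of $1$-perfectly orientable graphs is closed under each of the following operations: (1) disjoint union; (2) adding a universal vertex (join with $K_1$); (3) adding a true twin; (4) adding a simplicial vertex; (5) duplicating a $2$-branch in the complement; (6) vertex deletion; (7) edge contraction.
   Context: All graphs are finite and simple. An orientation of a graph $G$ is $1$-perfect if for every vertex $v$, its out-neighborhood is a clique in $G$; $G$ is $1$-perfectly orientable if it admits a $1$-perfect orientation. Two distinct vertices $u,v$ are true twins if $N[u]=N[v]$ (closed neighborhoods); adding a true twin of $w$ means adding a new vertex $v$ with $N[v]=N[w]\cup\{v\}$ in the new graph. A vertex is simplicial if its neighborhood is a clique, universal if adjacent to all other vertices; adding such a vertex means adding a new vertex with that property. A $2$-branch in a graph $G$ is a path $(a,b,c)$ with $\deg_G(b)=2$ and $\deg_G(c)=1$. Duplicating a $2$-branch $(a,b,c)$ of $G$ produces the graph $H$ with $V(H)=V(G)\cup\{b',c'\}$ ($b',c'$ new), $H-\{b',c'\}=G$, and $(a,b',c')$ a $2$-branch in $H$ (i.e. the only new edges are $ab'$ and $b'c'$). Duplicating a $2$-branch in the complement of $G$ means forming the complement of a graph obtained by duplicating a $2$-branch in $\overline{G}$. Contracting an edge $uv$ of $G$ replaces $u,v$ by a new vertex $w$ adjacent to every vertex of $(N(u)\cup N(v))\setminus\{u,v\}$, all other adjacencies unchanged. *)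

(* Defs.v *)
From HB Require Import structures.
From mathcomp Require Import all_boot.

Set Implicit Arguments.
Unset Strict Implicit.
Unset Printing Implicit Defensive.

Record sgraph := SGraph {
  svertex :> finType;
  sedge : rel svertex;
  sg_sym : symmetric sedge;
  sg_irrefl : irreflexive sedge }.

Notation "x -- y" := (sedge x y) (at level 30).

Section Basics.
Variable G : sgraph.
Implicit Types (x y v : G) (A : {set G}).

Definition nbhd v : {set G} := [set u | v -- u].
Definition cl_nbhd v : {set G} := v |: nbhd v.
Definition deg v : nat := #|nbhd v|.

Definition clique A : Prop := {in A &, forall x y, x != y -> x -- y}.

Definition simplicial v : Prop := clique (nbhd v).
Definition universal v : Prop := forall u : G, u != v -> v -- u.

(* D x y means that the edge xy is directed from x to y. *)
Definition orientation (D : rel G) : Prop :=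
  (forall x y, D x y -> x -- y) /\ (forall x y, x -- y -> D x y (+) D y x).

Definition one_perfect (D : rel G) : Prop :=
  forall v, clique [set u | D v u].

Definition one_perfectly_orientable : Prop :=
  exists2 D : rel G, orientation D & one_perfect D.

Definition two_branch (a b c : G) : Prop :=
  [/\ uniq [:: a; b; c], a -- b, b -- c, deg b = 2 & deg c = 1].

End Basics.

Section Complement.
Variable G : sgraph.

Definition compl_rel : rel G := fun x y => (x != y) && ~~ x -- y.

Lemma compl_sym : symmetric compl_rel.
Proof. by move=> x y; rewrite /compl_rel eq_sym sg_sym. Qed.

Lemma compl_irrefl : irreflexive compl_rel.
Proof. by move=> x; rewrite /compl_rel eqxx. Qed.

Definition compl : sgraph := SGraph compl_sym compl_irrefl.
End Complement.

Section DisjointUnion.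
Variables G1 G2 : sgraph.

Definition disj_union_rel : rel (G1 + G2)%type := fun x y =>
  match x, y with
  | inl x1, inl y1 => x1 -- y1
  | inr x2, inr y2 => x2 -- y2
  | _, _ => false
  end.

Lemma disj_union_sym : symmetric disj_union_rel.
Proof. by move=> [x|x] [y|y] //=; rewrite sg_sym. Qed.

Lemma disj_union_irrefl : irreflexive disj_union_rel.
Proof. by move=> [x|x] /=; rewrite sg_irrefl. Qed.

Definition disj_union : sgraph := SGraph disj_union_sym disj_union_irrefl.
End DisjointUnion.

Section Induced.
Variables (G : sgraph) (A : {set G}).

Definition induced_rel : rel {x : G | x \in A} := fun x y => val x -- val y.

Lemma induced_sym : symmetric induced_rel.
Proof. by move=> x y; rewrite /induced_rel sg_sym. Qed.

Lemma induced_irrefl : irreflexive induced_rel.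
Proof. by move=> x; rewrite /induced_rel sg_irrefl. Qed.

Definition induced : sgraph := SGraph induced_sym induced_irrefl.
End Induced.

Definition del_vertex (G : sgraph) (v : G) : sgraph := induced [set~ v].

(* [add_vertex N] is G with one new vertex, [None], whose neighborhood is N. *)
Section AddVertex.
Variables (G : sgraph) (N : {set G}).

Definition add_vertex_rel : rel (option G) := fun x y =>
  match x, y with
  | Some x', Some y' => x' -- y'
  | Some x', None => x' \in N
  | None, Some y' => y' \in N
  | None, None => false
  end.

Lemma add_vertex_sym : symmetric add_vertex_rel.
Proof. by move=> [x|] [y|] //=; rewrite sg_sym. Qed.

Lemma add_vertex_irrefl : irreflexive add_vertex_rel.
Proof. by move=> [x|] //=; rewrite sg_irrefl. Qed.

Definition add_vertex : sgraph := SGraph add_vertex_sym add_vertex_irrefl.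

Definition new_vertex : add_vertex := None.
Definition old_vertex (x : G) : add_vertex := Some x.
End AddVertex.

(* Duplicating a 2-branch (a, b, c): first b' is attached to a, then c' to b'.
   The resulting graph depends only on a. *)
Definition dup_two_branch (G : sgraph) (a : G) : sgraph :=
  add_vertex [set new_vertex [set a]].

Definition contract (G : sgraph) (u v : G) : sgraph :=
  @add_vertex (induced (~: [set u; v]))
    [set x | val x \in nbhd u :|: nbhd v].

(* Main.v *)
(** In each case a 1-perfect orientation D of the given graph is modified near
    the new vertices: a universal vertex becomes a sink, a simplicial vertex a
    source, and a true twin copies the arcs of its original.

    If (a, b, c) is a 2-branch of the complement, then c misses only b, and b
    misses only a and c. Since b and c are non-adjacent, no vertex points to
    both. Let b' copy the arcs of b and c' those of c, except that the arc
    between a and c' always goes to c'; the 4-cycle b, b', c, c' is oriented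
    cyclically.

    When an arc u -> v is contracted, the new vertex points exactly to the
    out-neighbors of v. A remaining neighbor x points to u or to v (if u -> x,
    then x and v are adjacent, as out-neighbors of u, so x -> v), hence the
    other out-neighbors of x are adjacent to u or v. *)

Require Import Defs.
From HB Require Import structures.
From mathcomp Require Import all_boot.

Set Implicit Arguments.
Unset Strict Implicit.
Unset Printing Implicit Defensive.

(** * Orientations and the pointwise form of 1-perfectness *)

Lemma one_perfectP (G : sgraph) (D : rel G) :
  one_perfect D <-> forall v x y, D v x -> D v y -> x != y -> x -- y.
Proof.
split=> [Dclq v x y Dvx Dvy | Dclq v x y]; first by apply: (Dclq v); rewrite inE.
by rewrite !inE; apply: Dclq.
Qed.

Lemma sedge_neq (G : sgraph) (x y : G) : x -- y -> x != y.
Proof. by apply: contraTneq => ->; rewrite sg_irrefl. Qed.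

Section OrientationTheory.
Variables (G : sgraph) (D : rel G).
Hypothesis Dor : orientation D.

Lemma orientation_edge x y : D x y -> x -- y.
Proof. by case: Dor => + _; apply. Qed.

Lemma orientation_nonedge x y : ~~ x -- y -> D x y = false.
Proof. by move=> nxy; apply/negbTE; apply: contra nxy; apply: orientation_edge. Qed.

Lemma orientation_irrefl x : D x x = false.
Proof. by apply: orientation_nonedge; rewrite sg_irrefl. Qed.

Lemma orientation_addb x y : x -- y -> D x y (+) D y x.
Proof. by case: Dor => _; apply. Qed.

Lemma orientation_total x y : x -- y -> D x y || D y x.
Proof. by move/orientation_addb; case: (D x y). Qed.

End OrientationTheory.

(** * Disjoint unions and single-vertex additions *)

Lemma opo_disj_union (G1 G2 : sgraph) :
  one_perfectly_orientable G1 -> one_perfectly_orientable G2 ->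
  one_perfectly_orientable (disj_union G1 G2).
Proof.
move=> [D1 [D1e D1o] /one_perfectP D1c] [D2 [D2e D2o] /one_perfectP D2c].
pose D : rel (disj_union G1 G2) := fun x y =>
  match x, y with
  | inl x1, inl y1 => D1 x1 y1
  | inr x2, inr y2 => D2 x2 y2
  | _, _ => false
  end.
exists D; first by split=> [] [x|x] [y|y] //=; auto.
by apply/one_perfectP => [] [v|v] [x|x] [y|y] //=; [apply: D1c | apply: D2c].
Qed.

Lemma opo_universal (G : sgraph) (N : {set G}) :
  universal (new_vertex N) ->
  one_perfectly_orientable G -> one_perfectly_orientable (add_vertex N).
Proof.
move=> univ [D [De Do] /one_perfectP Dc].
have NT x : x \in N by apply: (univ (Some x)).
pose D' : rel (add_vertex N) := fun x y =>
  match x, y with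
  | Some x', Some y' => D x' y'
  | Some _, None => true
  | None, _ => false
  end.
exists D'; first by split=> [] [x|] [y|] //=; auto.
(* The new vertex is a sink adjacent to all others, so an out-neighborhood that gains it remains a
   clique. *)
by apply/one_perfectP => [] [v|] [x|] [y|] //=; apply: Dc.
Qed.

Lemma opo_true_twin (G : sgraph) (w : G) (N : {set G}) :
  cl_nbhd (new_vertex N) = new_vertex N |: cl_nbhd (old_vertex N w) ->
  one_perfectly_orientable G -> one_perfectly_orientable (add_vertex N).
Proof.
move=> twin [D Dor /one_perfectP Dc].
have NE x : x \in N = (x == w) || w -- x.
  by move/setP/(_ (Some x)): twin; rewrite !inE /=.
(* The twins are adjacent; their edge is directed from [w] to the new vertex, the reverse arc being
   excluded by [D w w = false]. *)
pose D' : rel (add_vertex N) := fun x y =>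
  match x, y with
  | Some x', Some y' => D x' y'
  | Some x', None => (x' == w) || D x' w
  | None, Some y' => D w y'
  | None, None => false
  end.
have Dir := orientation_irrefl Dor; have De := @orientation_edge _ _ Dor.
have Do := @orientation_addb _ _ Dor.
exists D'.
  split=> [] [x|] [y|] //=; rewrite ?NE; auto.
  - by case/orP=> [->//|/De]; rewrite sg_sym => ->; rewrite orbT.
  - by move/De->; rewrite orbT.
  - by case: eqVneq => [->|_ /=]; rewrite ?Dir // sg_sym; apply: Do.
  - by case: eqVneq => [->|_ /=]; rewrite ?Dir //; apply: Do.
apply/one_perfectP => [] [v|] [x|] [y|] //=; try exact: Dc.
(* A vertex pointing to the twin is [w] itself or points to [w]; either way its other out-neighbors
   are adjacent or equal to [w]. *)
- move=> Dvx Dvw _; rewrite NE; case: eqVneq => //= nxw.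
  case/orP: Dvw => [/eqP <-|Dvw]; first exact: De.
  by apply: (Dc v); rewrite // eq_sym.
- move=> Dvw Dvy _; rewrite NE; case: eqVneq => //= nyw.
  case/orP: Dvw => [/eqP <-|Dvw]; first exact: De.
  by apply: (Dc v); rewrite // eq_sym.
Qed.

Lemma opo_simplicial (G : sgraph) (N : {set G}) :
  simplicial (new_vertex N) ->
  one_perfectly_orientable G -> one_perfectly_orientable (add_vertex N).
Proof.
move=> simpl [D [De Do] /one_perfectP Dc].
pose D' : rel (add_vertex N) := fun x y =>
  match x, y with
  | Some x', Some y' => D x' y'
  | Some _, None => false
  | None, Some y' => y' \in N
  | None, None => false
  end.
exists D'; first by split=> [] [x|] [y|] //=; auto; rewrite addbF.
(* No arc enters the new vertex, so the old out-neighborhoods are unchanged; its own is [N]. *)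
apply/one_perfectP => [] [v|] [x|] [y|] //=; first exact: Dc.
by move=> Nx Ny; apply: simpl; rewrite inE.
Qed.

(** * 2-branches in the complement *)

Lemma nbhd_deg1 (G : sgraph) (x y : G) : deg x = 1 -> x -- y -> nbhd x = [set y].
Proof.
move=> dx xy; apply/esym/eqP; rewrite eqEcard cards1 -/(deg x) dx leqnn andbT.
by rewrite sub1set inE.
Qed.

Lemma nbhd_deg2 (G : sgraph) (x y z : G) :
  deg x = 2 -> x -- y -> x -- z -> y != z -> nbhd x = [set y; z].
Proof.
move=> dx xy xz yz; apply/esym/eqP; rewrite eqEcard cards2 yz -/(deg x) dx andbT.
by rewrite subUset !sub1set !inE xy.
Qed.

Lemma opo_dup_two_branch (G : sgraph) (a b c : compl G) :
  two_branch a b c -> one_perfectly_orientable G ->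
  one_perfectly_orientable (compl (dup_two_branch a)).
Proof.
move=> [/=]; rewrite !inE andbT negb_or => /andP[/andP[nab nac] nbc] ab bc db dc.
move=> [D Dor /one_perfectP Dc].
have ba : b -- a by rewrite sg_sym.
have cb : c -- b by rewrite sg_sym.
(* The degrees in the complement determine the whole adjacency of [b] and [c] in [G]. *)
have bE (x : G) : @sedge G b x = [&& x != a, x != b & x != c].
  move/setP/(_ x): (nbhd_deg2 db ba bc nac).
  rewrite !inE /= /compl_rel (eq_sym _ x).
  case: (eqVneq x b) => [-> _|_ /=]; first by rewrite sg_irrefl andbF.
  by rewrite -negb_or => /(congr1 negb); rewrite negbK.
have cE (x : G) : @sedge G c x = (x != b) && (x != c).
  move/setP/(_ x): (nbhd_deg1 dc cb).
  rewrite !inE /= /compl_rel (eq_sym _ x).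
  case: (eqVneq x c) => [-> _|_ /=]; first by rewrite sg_irrefl andbF.
  by move/(congr1 negb); rewrite negbK andbT.
(* The new vertices b' and c' are Some None and None. *)
pose D' : rel (compl (dup_two_branch a)) := fun x y =>
  match x, y with
  | Some (Some x'), Some (Some y') => D x' y'
  | Some None, Some (Some y') => D b y' || (y' == c)
  | Some (Some x'), Some None => D x' b || (x' == b)
  | None, Some (Some y') => (y' == b) || (D c y' && (y' != a))
  | Some (Some x'), None => [|| x' == c, D x' c | x' == a]
  | _, _ => false
  end.
have HE (x y : compl (dup_two_branch a)) : x -- y =
    match x, y with
    | Some (Some x'), Some (Some y') => @sedge G x' y'
    | Some None, Some (Some z) | Some (Some z), Some None => z != a
    | None, Some (Some _) | Some (Some _), None => true
    | _, _ => false
    end.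
  case: x y => [[x|]|] [[y|]|] //=; rewrite /compl_rel /= ?inE //.
  (* On old vertices the double complement gives back the adjacency of [G]. *)
  rewrite (inj_eq Some_inj) (inj_eq Some_inj) /compl_rel.
  by case: eqVneq => [->|]; rewrite ?sg_irrefl ?negbK.
have Dir := orientation_irrefl Dor; have De := @orientation_edge _ _ Dor.
have Do := @orientation_addb _ _ Dor; have Dn := orientation_nonedge Dor.
have Dba : D b a = false by rewrite Dn // bE eqxx.
have Dbc : D b c = false by rewrite Dn // bE eqxx !andbF.
have Dab : D a b = false by rewrite Dn // sg_sym bE eqxx.
have Dcb : D c b = false by rewrite Dn // cE eqxx.
have Dout v : D v b -> D v c -> False.
  by move=> vb vc; have := Dc _ _ _ vb vc nbc; rewrite bE eqxx !andbF.
have Dout' v : D v b -> D v a -> False.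
  by move=> vb va; have := Dc _ _ _ va vb nab; rewrite sg_sym bE eqxx.
have Nb x : D b x -> x != a by apply: contraTneq => ->; rewrite Dba.
have Nb' x : D x b -> x != a by apply: contraTneq => ->; rewrite Dab.
have Ob x : x != a -> (D x b || (x == b)) (+) (D b x || (x == c)).
  move=> nxa; case: (eqVneq x b) => [->|nxb].
    by rewrite Dir (negbTE nbc).
  case: (eqVneq x c) => [->|nxc]; first by rewrite Dcb orbT.
  by rewrite !orbF addbC Do // bE nxa nxb.
(* The arc between [a] and c' is forced towards c': since c' points to [b], it cannot also point to
   [a], which is not adjacent to [b]. *)
have Oc x : [|| x == c, D x c | x == a] (+) ((x == b) || D c x && (x != a)).
  case: (eqVneq x c) => [->|nxc]; first by rewrite Dir [c == b]eq_sym (negbTE nbc).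
  case: (eqVneq x a) => [->|nxa]; first by rewrite orbT andbF orbF (negbTE nab).
  case: (eqVneq x b) => [->|nxb]; first by rewrite Dbc.
  by rewrite orbF andbT addbC Do // cE nxb.
(* Among old vertices b' misses only [a], so this makes b' adjacent to the old out-neighbors of any
   old vertex pointing to it. *)
have Da v x : D v b || (v == b) -> D v x -> x != a.
  case/orP=> [Dvb|/eqP->]; last exact: Nb.
  by apply: contraTneq => -> ; apply/negP; apply: Dout'.
(* As b' and c' are non-adjacent, no vertex may point to both. *)
have Dbc' v : D v b || (v == b) -> [|| v == c, D v c | v == a] -> False.
  case/orP=> [Dvb|/eqP->]; case/or3P.
  - by move/eqP=> vc; rewrite vc Dcb in Dvb.
  - exact: Dout.
  - by move/eqP=> va; rewrite va Dab in Dvb.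
  - by rewrite (negbTE nbc).
  - by rewrite Dbc.
  - by rewrite eq_sym (negbTE nab).
(* For the out-neighborhoods of the new vertices: b' has that of [b] plus [c], and c' has that of
   [c] without [a], plus [b]. *)
have Cb y : D b y -> @sedge G y c.
  move=> Dby; rewrite sg_sym cE eq_sym (sedge_neq (De _ _ Dby)).
  by apply: contraTneq Dby => ->; rewrite Dbc.
have Cc y : D c y -> y != a -> @sedge G b y.
  by move/De; rewrite cE bE => /andP[-> ->] ->.
exists D'.
  split=> [] [[x|]|] [[y|]|] //; rewrite HE /=; auto.
  - by case/orP=> [/Nb'|/eqP->] //; rewrite eq_sym.
  - by case/orP=> [/Nb|/eqP->] //; rewrite eq_sym.
  - by rewrite addbC; apply: Ob.
  - by move=> _; rewrite addbC; apply: Oc.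
apply/one_perfectP => [] [[v|]|] [[x|]|] [[y|]|] //; rewrite HE /= ?eqxx //.
- exact: Dc.
- by move=> Dvx Dvb _; apply: Da Dvx.
- by move=> Dvb Dvy _; apply: Da Dvy.
- by move=> Dvb Dvc; case: (Dbc' v).
- by move=> Dvc Dvb; case: (Dbc' v).
- case/orP=> [Dbx|/eqP->] /orP[Dby|/eqP->] nxy.
  + exact: (Dc b).
  + exact: Cb.
  + by rewrite sg_sym Cb.
  + by rewrite eqxx in nxy.
- case/orP=> [/eqP->|/andP[Dcx nxa]] /orP[/eqP->|/andP[Dcy nya]] nxy.
  + by rewrite eqxx in nxy.
  + exact: Cc.
  + by rewrite sg_sym Cc.
  + exact: (Dc c).
Qed.

(** * Vertex deletion and edge contraction *)

Lemma opo_induced (G : sgraph) (A : {set G}) :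
  one_perfectly_orientable G -> one_perfectly_orientable (induced A).
Proof.
move=> [D [De Do] /one_perfectP Dc].
exists (fun x y => D (val x) (val y)).
  by split=> x y; [apply: De | apply: Do].
by apply/one_perfectP => v x y vx vy nxy; apply: Dc vx vy _.
Qed.

(** By this symmetry the contracted edge may be assumed to be directed from [u] to [v]. *)
Lemma contractC (G : sgraph) (u v : G) : contract u v = contract v u.
Proof. by rewrite /contract [nbhd u :|: _]setUC [[set u; v]]setUC. Qed.

Lemma opo_contract_arc (G : sgraph) (D : rel G) (u v : G) :
  orientation D -> one_perfect D -> D u v ->
  one_perfectly_orientable (contract u v).
Proof.
move=> Dor /one_perfectP Dc Duv.
have De := @orientation_edge _ _ Dor; have Do := @orientation_addb _ _ Dor.
have Dt := orientation_total Dor.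
(* The conjunct [~~ D v (val x')] settles a directed triangle u -> v -> x -> u: the arc leaving [v]
   prevails. *)
pose D' : rel (contract u v) := fun x y =>
  match x, y with
  | Some x', Some y' => D (val x') (val y')
  | Some x', None => ~~ D v (val x') && (D (val x') u || D (val x') v)
  | None, Some y' => D v (val y')
  | None, None => false
  end.
(* Thus the edge between an out-neighbor of [u] and the new vertex takes its direction from the edge
   to [v]. *)
have out x : x != v -> D u x -> D x v || D v x.
  by move=> nxv Dux; apply: Dt; apply: Dc Dux Duv nxv.
exists D'.
  split=> [] [[x Ax]|] [[y Ay]|] //=; rewrite ?inE /=.
  - exact: De.
  - by case/andP=> _ /orP[] /De; rewrite sg_sym => ->; rewrite ?orbT.
  - by move/De->; rewrite orbT.
  - exact: Do.
  - case Dvx: (D v x) => //= uvx.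
    rewrite addbF; case/orP: uvx => [/Dt/orP[Dux|->] // | /Dt].
      have: x != v by move: Ax; rewrite !inE negb_or => /andP[].
      by move/out/(_ Dux); rewrite Dvx orbF => ->; rewrite orbT.
    by rewrite Dvx => /= ->; rewrite orbT.
  - case Dvy: (D v y) => //= uvy.
    case/orP: uvy => [/Dt/orP[Duy|->] // | /Dt].
      have: y != v by move: Ay; rewrite !inE negb_or => /andP[].
      by move/out/(_ Duy); rewrite Dvy orbF => ->; rewrite orbT.
    by rewrite Dvy => /= ->; rewrite orbT.
have near x y : D x u || D x v -> D x y -> y != u -> y != v ->
    (u -- y) || (v -- y).
  move=> /orP[Dxu|Dxv] Dxy nyu nyv.
    by rewrite (Dc x) // eq_sym.
  by rewrite (Dc x v) ?orbT // eq_sym.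
apply/one_perfectP => [] [[t At]|] [[x Ax]|] [[y Ay]|] //=; rewrite ?inE /=.
- exact: Dc.
- move=> Dtx /andP[_ Dtuv] _; move: Ax; rewrite !inE negb_or => /andP[].
  exact: near Dtx.
- move=> /andP[_ Dtuv] Dty _; move: Ay; rewrite !inE negb_or => /andP[].
  exact: near Dty.
- exact: Dc.
Qed.

Lemma opo_contract (G : sgraph) (u v : G) :
  u -- v -> one_perfectly_orientable G ->
  one_perfectly_orientable (contract u v).
Proof.
move=> uv [D Dor D1]; case/orP: (orientation_total Dor uv) => [Duv|Dvu].
  exact: opo_contract_arc Dor D1 Duv.
by rewrite contractC; apply: opo_contract_arc Dor D1 Dvu.
Qed.

Theorem theorem6 :
  (forall G1 G2 : sgraph,
      one_perfectly_orientable G1 -> one_perfectly_orientable G2 ->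
      one_perfectly_orientable (disj_union G1 G2)) /\
  (forall (G : sgraph) (N : {set G}),
      universal (new_vertex N) ->
      one_perfectly_orientable G -> one_perfectly_orientable (add_vertex N)) /\
  (forall (G : sgraph) (w : G) (N : {set G}),
      cl_nbhd (new_vertex N) = new_vertex N |: cl_nbhd (old_vertex N w) ->
      one_perfectly_orientable G -> one_perfectly_orientable (add_vertex N)) /\
  (forall (G : sgraph) (N : {set G}),
      simplicial (new_vertex N) ->
      one_perfectly_orientable G -> one_perfectly_orientable (add_vertex N)) /\
  (forall (G : sgraph) (a b c : compl G),
      two_branch a b c ->
      one_perfectly_orientable G ->
      one_perfectly_orientable (compl (dup_two_branch a))) /\
  (forall (G : sgraph) (v : G),
      one_perfectly_orientable G -> one_perfectly_orientable (del_vertex v)) /\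
  (forall (G : sgraph) (u v : G),
      u -- v ->
      one_perfectly_orientable G -> one_perfectly_orientable (contract u v)).
Proof.
split; first exact: opo_disj_union.
split; first exact: opo_universal.
split; first exact: opo_true_twin.
split; first exact: opo_simplicial.
split; first exact: opo_dup_two_branch.
split; first by move=> G v; apply: opo_induced.
exact: opo_contract.
Qed.
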